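(* For any Banach space $X$, the following assertions hold: (a) If $X^*$ has the dual quantitative Dunford-Pettis property then $X$ has the direct quantitative Dunford-Pettis property. (b) If $X^*$ has the direct quantitative Dunford-Pettis property then $X$ has the dual quantitative Dunford-Pettis property.
   Context: Banach spaces are real or complex; $B_X$ is the closed unit ball; operator means bounded linear operator. For a bounded sequence $(z_k)$ in a Banach space, $\operatorname{ca}(z_k)=\inf_{n}\sup_{k,l\ge n}\|z_k-z_l\|$. For an operator $S:Z\to W$, $\operatorname{cc}(S)=\sup\{\operatorname{ca}(Sz_k):(z_k)\text{ is a weakly Cauchy sequence in }B_Z\}$. For a bounded subset $A$ of a Banach space $Z$, $\operatorname{wk}_Z(A)=\sup\{\operatorname{dist}(z^{**},Z):z^{**}\in\overline{A}^{w^*}\}$, with $\overline{A}^{w^*}$ the weak$^*$ closure of $A$ in $Z^{**}$ ($Z$ canonically embedded in $Z^{**}$). For an operator $S:Z\to W$, $\operatorname{wk}_W(S)=\operatorname{wk}_W(S(B_Z))$. $X$ has the direct quantitative Dunford-Pettis property if there is $C>0$ such that $\operatorname{cc}(T)\le C\operatorname{wk}_{X^*}(T^* )$ for every Banach space $Y$ and every operator $T:X\to Y$ (equivalently, there is $C>0$ with $\operatorname{cc}(T)\le C\operatorname{wk}_Y(T)$ for all such $T$). $X$ has the dual quantitative Dunford-Pettis property if there is $C>0$ such that $\operatorname{cc}(T^* )\le C\operatorname{wk}_X(T)$ for every Banach space $Y$ and every operator $T:Y\to X$. *)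

(* Defs.v *)
From HB Require Import structures.
From mathcomp Require Import all_boot all_order all_algebra.
From mathcomp Require Import all_classical all_reals all_analysis.
From mathcomp Require Import complex.

Set Implicit Arguments.
Unset Strict Implicit.
Unset Printing Implicit Defensive.

Import Order.TTheory GRing.Theory Num.Theory.
Import numFieldNormedType.Exports.

Local Open Scope classical_set_scope.
Local Open Scope ring_scope.

(* Norms of a [normedModType K] take their values in [K] itself.  A value of
   type [scalars R K] says that [K] is the real field [R] or the complex field
   [R[i]], and [re], [ofr] move norms between [K] and [R], where suprema and
   infima live. *)
Variant scalars (R : realType) : numFieldType -> Type :=
| RealScalars : scalars R R
| ComplexScalars : scalars R R[i].

Section Scalars.
Context (R : realType).

Definition re (K : numFieldType) (S : scalars R K) : K -> R :=
  match S in scalars _ K return K -> R with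
  | RealScalars => fun x => x
  | ComplexScalars => fun x => complex.Re x
  end.

Definition ofr (K : numFieldType) (S : scalars R K) : R -> K :=
  match S in scalars _ K return R -> K with
  | RealScalars => fun x => x
  | ComplexScalars => fun x => real_complex R x
  end.

Context (K : numFieldType) (S : scalars R K).

Lemma ofrK r : re S (ofr S r) = r.
Proof. by case: S. Qed.

Lemma reK x : 0 <= x -> ofr S (re S x) = x.
Proof.
case: S x => //= -[a b]; rewrite lecE /= => /andP[/eqP -> _]; exact: erefl.
Qed.

Lemma re0 : re S 0 = 0. Proof. by case: S. Qed.

Lemma ler_re x y : x <= y -> re S x <= re S y.
Proof. by case: S x y => //= -[a b] [c d]; rewrite lecE => /andP[]. Qed.

Lemma ler_ofr r s : (ofr S r <= ofr S s) = (r <= s).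
Proof. by case: S => //=; rewrite lecR. Qed.

Lemma ofr0 : ofr S 0 = 0. Proof. by case: S. Qed.

Lemma re_ge0 x : 0 <= x -> 0 <= re S x.
Proof. by move=> /ler_re; rewrite re0. Qed.

Lemma complex_complete (F : set_system (R[i] : numFieldType)^o) :
  ProperFilter F -> cauchy F -> cvg F.
Proof.
move=> FF /cauchy_ballP Fc.
have normRe (x : R[i]) : `|complex.Re x| <= complex.Re `|x|.
  by rewrite -lecR; case: x => a b; rewrite normc_def /= lecR -sqrtr_sqr
     ler_wsqrtr// lerDl sqr_ge0.
have normIm (x : R[i]) : `|complex.Im x| <= complex.Re `|x|.
  by rewrite -lecR; case: x => a b; rewrite normc_def /= lecR -sqrtr_sqr
     ler_wsqrtr// lerDr sqr_ge0.
have key (p : R[i] -> R) : (forall x y, p x - p y = p (x - y)) ->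
    (forall x, `|p x| <= complex.Re `|x|) -> cvg (p @ F).
  move=> pB pn; apply: R_complete; apply/cauchy_ballP => e e0.
  have e0' : 0 < (e%:C)%C :> R[i] by rewrite ltcR.
  have := Fc _ e0'; rewrite !near_simpl => H.
  rewrite near_map2; apply: filterS H => -[x y] /=.
  rewrite -!ball_normE /= pB => xy; apply: le_lt_trans (pn _) _.
  by move: xy; rewrite ltcE => /andP[_].
have /cvg_ex[/= a Fa] : cvg (@complex.Re R @ F).
  by apply: key => // -[a b] [c d].
have /cvg_ex[/= b Fb] : cvg (@complex.Im R @ F).
  by apply: key => // -[? ?] [c d].
apply/cvg_ex; exists (Complex a b); apply/cvgrPdist_lt => e e0.
have [r e_r] : exists r, e = (r%:C)%C.
  by move: e0; case: e => r i; rewrite ltcE /= => /andP[/eqP ->]; exists r.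
rewrite e_r in e0 *; move: e0; rewrite ltcR => r0.
have r20 : 0 < r / 2 by rewrite divr_gt0.
move/cvgrPdist_lt : Fa => /(_ _ r20) Fa; move/cvgrPdist_lt : Fb => /(_ _ r20) Fb.
have {}Fa : F [set x | `|a - complex.Re x| < r / 2] by exact: Fa.
have {}Fb : F [set x | `|b - complex.Im x| < r / 2] by exact: Fb.
rewrite near_simpl; apply: filterS2 Fa Fb => x /= xa xb.
have -> : Complex a b - x = ((a - complex.Re x)%:C)%C +
    'i%C * ((b - complex.Im x)%:C)%C.
  by rewrite [LHS]complexE; case: x {xa xb}.
apply: le_lt_trans (ler_normD _ _) _.
rewrite normrM !normc_def /= !expr0n /= !expr1n !addr0 add0r sqrtr1 mul1r !sqrtr_sqr.
by rewrite -rmorphD /= ltcR (splitr r) ltrD.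
Qed.

Lemma scalars_complete (F : set_system K^o) :
  ProperFilter F -> cauchy F -> cvg F.
Proof. by case: S F => F; [exact: R_complete|exact: complex_complete]. Qed.

End Scalars.

Section BoundedOperators.
Context (K : numFieldType) (V W : normedModType K).

Definition bounded_op : {pred V -> W} := [pred f : V -> W |
  `[< linear f /\ exists M : K, forall x, `|f x| <= M * `|x| >]].

Record bop := Bop { bop_fun :> V -> W; _ : bop_fun \in bounded_op }.

HB.instance Definition _ := [isSub for bop_fun].
HB.instance Definition _ := [Choice of bop by <:].

Lemma bopP (f : bop) : linear f /\ exists M : K, forall x, `|f x| <= M * `|x|.
Proof. by case: f => f /= /asboolP. Qed.

Lemma bopE (f g : bop) : (forall x, f x = g x) -> f = g.
Proof. by move=> fg; apply: val_inj; apply/funext. Qed.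

HB.instance Definition _ (f : bop) :=
  GRing.isLinear.Build K V W *:%R (bop_fun f) (proj1 (bopP f)).

Lemma bounded_op_submod : submod_closed bounded_op.
Proof.
split.
  apply/asboolP; split; first by move=> a x y /=; rewrite scaler0 addr0.
  by exists 0 => x; rewrite normr0 mul0r.
move=> a f g /asboolP[fl [M fM]] /asboolP[gl [N gN]]; apply/asboolP; split.
  move=> b x y; rewrite !fctE fl gl !scalerDr addrACA !scalerA.
  by rewrite [a * b]mulrC.
exists (`|a| * M + N) => x; rewrite !fctE mulrDl.
by rewrite (le_trans (ler_normD _ _))// lerD// normrZ -mulrA ler_wpM2l.
Qed.

HB.instance Definition _ := GRing.isSubmodClosed.Build K (V -> W) bounded_op
  bounded_op_submod.
HB.instance Definition _ := [SubChoice_isSubLmodule of bop by <:].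

End BoundedOperators.
Arguments bounded_op {K} V W.

Definition unit_ball (K : numFieldType) (V : normedModType K) : set V :=
  [set x | `|x| <= 1].
Arguments unit_ball {K} V.

Definition nrm (R : realType) (K : numFieldType) (S : scalars R K)
  (V : normedModType K) (x : V) : R := re S `|x|.

Definition dual (R : realType) (K : numFieldType) (S : scalars R K)
  (V : normedModType K) : Type := bop V K^o.

Section Dual.
Context (R : realType) (K : numFieldType) (S : scalars R K)
  (V : normedModType K).
Local Notation dual := (dual S V).

HB.instance Definition _ := GRing.Lmodule.on dual.

Definition dual_norm (f : dual) : K :=
  ofr S (sup [set nrm S (f x : K^o) | x in unit_ball V]).

Lemma dual_has_sup (f : dual) :
  has_sup [set nrm S (f x : K^o) | x in unit_ball V].
Proof.
split; first by exists (nrm S (f 0 : K^o)), 0 => //; rewrite /unit_ball/= normr0.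
have [_ [M fM]] := bopP f; exists (re S `|M|) => _ [x x1 <-].
apply: ler_re; rewrite (le_trans (fM x))// (le_trans (_ : _ <= `|M| * `|x|))//.
  have [->|x0] := eqVneq x 0; first by rewrite normr0 !mulr0.
  rewrite ler_wpM2r// real_ler_norm//.
  have := le_trans (normr_ge0 _) (fM x); rewrite pmulr_lge0 ?normr_gt0// => M0.
  exact: ger0_real.
by rewrite ler_piMr.
Qed.

Lemma dual_norm_ge0 f : 0 <= dual_norm f.
Proof.
rewrite /dual_norm -(ofr0 S) ler_ofr.
have B0 : [set nrm S (f x : K^o) | x in unit_ball V] (nrm S (f 0 : K^o)).
  by exists 0 => //; rewrite /unit_ball/= normr0.
apply: le_trans (sup_ubound (dual_has_sup f).2 B0).
by apply: re_ge0; exact: normr_ge0.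
Qed.

Lemma dual_norm_apply (f : dual) x : `|f x| <= dual_norm f * `|x|.
Proof.
have [->|x0] := eqVneq x 0; first by rewrite linear0 !normr0 mulr0.
have nx0 : 0 < `|x| by rewrite normr_gt0.
rewrite -ler_pdivrMr//.
have -> : `|f x| / `|x| = `|f (`|x|^-1 *: x)|.
  by rewrite linearZ /= normrZ normfV normr_id mulrC.
rewrite -(reK S (normr_ge0 _)) /dual_norm ler_ofr.
apply: sup_ubound; first exact: (dual_has_sup f).2.
exists (`|x|^-1 *: x) => //.
by rewrite /unit_ball/= normrZ normfV normr_id mulVf// gt_eqF.
Qed.

Lemma dual_norm_le (f : dual) (M : K) : 0 <= M -> (forall x, `|f x| <= M * `|x|) ->
  dual_norm f <= M.
Proof.
move=> M0 fM; rewrite -[leRHS](reK S)// ler_ofr.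
apply: ge_sup; first exact: (dual_has_sup f).1.
move=> _ [x x1 <-]; apply: ler_re; apply: le_trans (fM x) _.
by rewrite ler_piMr.
Qed.

Lemma dual_normD (f g : dual) : dual_norm (f + g) <= dual_norm f + dual_norm g.
Proof.
apply: dual_norm_le => [|x]; first by rewrite addr_ge0 ?dual_norm_ge0.
by rewrite mulrDl (le_trans (ler_normD _ _))// lerD ?dual_norm_apply.
Qed.

Lemma dual_normZ a (f : dual) : dual_norm (a *: f) = `|a| * dual_norm f.
Proof.
have le b h : dual_norm (b *: h) <= `|b| * dual_norm h.
  apply: dual_norm_le => [|x]; first by rewrite mulr_ge0 ?dual_norm_ge0.
  by rewrite -mulrA normrZ ler_wpM2l// dual_norm_apply.
apply/eqP; rewrite eq_le le /=.
have [->|a0] := eqVneq a 0; first by rewrite normr0 mul0r dual_norm_ge0.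
rewrite -ler_pdivlMl ?normr_gt0// -normfV.
by rewrite -[leLHS]/(dual_norm f) -{1}[f]scale1r -(mulVf a0) -scalerA le.
Qed.

Lemma dual_norm0_eq0 (f : dual) : dual_norm f = 0 -> f = 0.
Proof.
move=> f0; apply: bopE => x; apply/eqP.
by rewrite -normr_le0 (le_trans (dual_norm_apply f x))// f0 mul0r.
Qed.

HB.instance Definition _ := Lmodule_isNormed.Build K dual
  dual_normD dual_normZ dual_norm0_eq0.

Lemma dual_complete (F : set_system dual) :
  ProperFilter F -> cauchy F -> cvg F.
Proof.
move=> FF /cauchy_ballP Fc.
have Fx x : cvg ((fun f : dual => f x : K^o) @ F).
  apply: scalars_complete; first exact: S.
  apply/cauchy_ballP => e e0.
  have d0 : 0 < e / (1 + `|x|) by rewrite divr_gt0// ltr_wpDr.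
  rewrite near_map2; apply: filterS (Fc _ d0) => -[f g] /=.
  rewrite -!ball_normE /= => fg.
  rewrite -[_ - _]/((f - g) x).
  apply: le_lt_trans (dual_norm_apply _ _) _.
  apply: (@le_lt_trans _ _ (dual_norm (f - g) * (1 + `|x|))).
    by rewrite ler_wpM2l ?dual_norm_ge0// lerDr.
  by rewrite -ltr_pdivlMr// ltr_wpDr.
pose g x : K^o := lim ((fun f : dual => f x : K^o) @ F).
have gl : linear g.
  move=> a x y; apply: cvg_lim => //.
  under eq_fun do rewrite linearP.
  by apply: cvgD; [apply: cvgZr; exact: Fx|exact: Fx].
have Fg e : 0 < e -> \forall f \near F, forall x, `|(f : dual) x - g x| <= e * `|x|.
  move=> e0; have e20 : 0 < e / 2 by rewrite divr_gt0.
  have [A FA Ae] : exists2 A, F A &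
      forall f h, A f -> A h -> dual_norm (f - h) <= e / 2.
    have [[A B] /= [FA FB] AB] := Fc _ e20.
    exists (A `&` B); first exact: filterI.
    move=> f h [Af _] [_ Bh]; have := AB (f, h) (conj Af Bh).
    by rewrite /= -ball_normE => /ltW.
  apply: filterS (FA) => f Af x.
  have [->|x0] := eqVneq x 0.
    have g0 : g 0 = 0.
      by have := gl (-1) 0 0; rewrite scaler0 add0r scaleN1r addNr.
    by rewrite g0 linear0 subrr !normr0 mulr0.
  have d0 : 0 < e / 2 * `|x| by rewrite mulr_gt0 ?normr_gt0.
  have := Fx x; move/cvgrPdist_le => /(_ _ d0) Fxd.
  have [h [Ah hx]] := filter_ex (filterI FA Fxd).
  rewrite -(subrKA (h x)) (le_trans (ler_normD _ _))// [e in leRHS]splitr.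
  rewrite mulrDl lerD//; last by rewrite distrC.
  by apply: le_trans (dual_norm_apply (f - h) x) _; rewrite ler_wpM2r// Ae.
have gb : exists M : K, forall x, `|g x| <= M * `|x|.
  have [f fg] := filter_ex (Fg 1 ltr01).
  exists (1 + dual_norm f) => x.
  rewrite -(subrK (f x) (g x)) (le_trans (ler_normD _ _))// mulrDl lerD//.
    by rewrite distrC.
  exact: dual_norm_apply.
have gP : g \in bounded_op V K^o by apply/asboolP.
apply/cvg_ex; exists (Bop gP : dual); apply/cvgrPdist_le => e e0.
apply: filterS (Fg e e0) => f fg.
apply: dual_norm_le => [|x]; first exact: ltW.
by rewrite -[X in `|X|]/(g x - f x) distrC.
Qed.

HB.instance Definition _ := Uniform_isComplete.Build dual dual_complete.

End Dual.

Section Quantities.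
Context (R : realType) (K : numFieldType) (S : scalars R K).

Section Adjoint.
Context (V W : normedModType K) (T : bop V W).

Lemma adjoint_subproof (g : dual S W) : (g \o T : V -> K^o) \in bounded_op V K^o.
Proof.
apply/asboolP; split; first by move=> a x y; rewrite /= !linearP.
have [_ [M TM]] := bopP T; exists (dual_norm g * M) => x /=.
apply: le_trans (dual_norm_apply g (T x)) _.
by rewrite -mulrA ler_wpM2l ?dual_norm_ge0.
Qed.

Definition adjoint_fun (g : dual S W) : dual S V := Bop (adjoint_subproof g).

Lemma adjoint_bounded : adjoint_fun \in bounded_op (dual S W) (dual S V).
Proof.
apply/asboolP; split; first by move=> a g h; exact: bopE.
have [_ [M TM]] := bopP T; exists `|M| => g.
apply: dual_norm_le => [|x]; first by rewrite mulr_ge0.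
rewrite mulrAC; apply: le_trans (dual_norm_apply g (T x)) _.
rewrite mulrC ler_wpM2r ?dual_norm_ge0//.
have [->|x0] := eqVneq x 0; first by rewrite linear0 !normr0 mulr0.
rewrite (le_trans (TM x))// ler_wpM2r// real_ler_norm//.
have := le_trans (normr_ge0 _) (TM x); rewrite pmulr_lge0 ?normr_gt0// => M0.
exact: ger0_real.
Qed.

Definition adjoint : bop (dual S W) (dual S V) := Bop adjoint_bounded.

End Adjoint.

Section Canonical.
Context (V : normedModType K).

Lemma bidual_embedding_subproof (x : V) :
  (fun f : dual S V => f x : K^o) \in bounded_op (dual S V) K^o.
Proof.
apply/asboolP; split=> [a f g //|]; exists `|x| => f.
by rewrite mulrC; exact: dual_norm_apply.
Qed.

Definition bidual_embedding (x : V) : dual S (dual S V) := Bop (bidual_embedding_subproof x).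

End Canonical.

(* V^* with its weak-star topology: the coarsest one making all the
   evaluations f |-> f x continuous. *)
Definition weak_star (V : normedModType K) : Type :=
  initial_topology (fun f : dual S V => (f : V -> K^o) : {ptws V -> K^o}).

HB.instance Definition _ (V : normedModType K) :=
  Topological.on (weak_star V).

Definition weakly_cauchy (V : normedModType K) (z : nat -> V) : Prop :=
  forall f : dual S V, cauchy ((fun k => f (z k) : K^o) @ \oo).

Local Open Scope ereal_scope.

Definition ca (V : normedModType K) (z : nat -> V) : \bar R :=
  ereal_inf [set ereal_sup [set (nrm S (z k - z l)%R)%:E |
                             k in [set k | (n <= k)%N] & l in [set l | (n <= l)%N]] |
             n in [set: nat]].

Definition cc (V W : normedModType K) (T : bop V W) : \bar R :=
  ereal_sup [set ca (T \o z) | z in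
    [set z : nat -> V | weakly_cauchy z /\ forall k, unit_ball V (z k)]].

Definition dist (V : normedModType K) (x : V) (A : set V) : \bar R :=
  ereal_inf [set (nrm S (x - a)%R)%:E | a in A].

Definition wk (V : normedModType K) (A : set V) : \bar R :=
  ereal_sup [set dist z (range (@bidual_embedding V)) | z in
    closure (@bidual_embedding V @` A : set (weak_star (dual S V)))].

Definition wk_op (V W : normedModType K) (T : bop V W) : \bar R :=
  wk (T @` unit_ball V).

Definition direct_quantitative_DP (X : completeNormedModType K) : Prop :=
  exists2 C : R, (0 < C)%R &
  forall (Y : completeNormedModType K) (T : bop X Y),
    cc T <= C%:E * wk_op (adjoint T).

Definition dual_quantitative_DP (X : completeNormedModType K) : Prop :=
  exists2 C : R, (0 < C)%R &
  forall (Y : completeNormedModType K) (T : bop Y X),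
    cc (adjoint T) <= C%:E * wk_op T.

End Quantities.

(* Main.v *)
Require Import Defs.
From HB Require Import structures.
From mathcomp Require Import all_boot all_order all_algebra.
From mathcomp Require Import all_classical all_reals all_analysis.
From mathcomp Require Import complex ring lra.

(** Write J for the canonical embedding of a space in its bidual.

    Both implications apply the hypothesis on X^* to the adjoint T^* of the
    operator T in question, which brings in the biadjoint T^**.

    (a) For T : X -> Y the hypothesis gives cc(T^** ) <= C wk(T^* ), and
    cc(T) <= cc(T^** ) always holds (cc_le_biadjoint): J sends weakly Cauchy
    sequences of the unit ball to such sequences, T^** J = J T, and J is
    isometric by the Hahn-Banach theorem, so that oscillations are preserved.

    (b) For T : Y -> X the hypothesis gives cc(T^* ) <= C wk(T^** ), and
    wk(T^** ) <= 3 wk(T) always holds (wk_biadjoint_le), half of a quantitative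
    Gantmacher theorem.  Let s > wk(T).  By Goldstine's theorem T^** maps the
    ball of Y^** into the weak-star closure of J(T(B_Y)), so every T^** psi with
    |psi| <= 1 has the form J x + u with |u| < s.  Let z in X^**** be a weak-star
    cluster point of such elements.  Its restriction to X^* again lies in the
    weak-star closure of J(T(B_Y)), so it is J x1 + u1 with |u1| < s.  For chi in
    the ball of X^*** put f = chi o J, an element of X^*.  Since chi and J f agree
    on J x, their values at any T^** psi differ by at most 2s, hence z(chi) and
    z(J f) differ by at most 2s; and z(J f) = f(x1) + u1(f), where
    f(x1) = chi(J x1).  Hence |z - J(J x1)| <= 3s.

    Everything rests on the Hahn-Banach theorem for seminorms over R or R[i]
    (Hahn_Banach), obtained from minimal sublinear functionals.  It yields norming
    functionals and, applied to a suitable seminorm on K^n, the finite-dimensional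
    core of Goldstine's theorem (Helly). *)

Set Implicit Arguments.
Unset Strict Implicit.
Unset Printing Implicit Defensive.

Import Order.TTheory GRing.Theory Num.Theory.
Import numFieldNormedType.Exports.

Local Open Scope classical_set_scope.
Local Open Scope ring_scope.

(** * Scalars and real-valued norms *)

Section ScalarMorphisms.
Context (R : realType) (K : numFieldType) (S : scalars R K).

Lemma ofr1 : ofr S 1 = 1. Proof. by case: S. Qed.

Lemma ofrD r s : ofr S (r + s) = ofr S r + ofr S s.
Proof. by case: S => //=; rewrite rmorphD. Qed.

Lemma ofrM r s : ofr S (r * s) = ofr S r * ofr S s.
Proof. by case: S => //=; rewrite rmorphM. Qed.

Lemma ofr_ge0 r : 0 <= r -> 0 <= ofr S r.
Proof. by rewrite -(ofr0 S) ler_ofr. Qed.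

Lemma reD x y : re S (x + y) = re S x + re S y.
Proof. by case: S x y => //= -[? ?] [? ?]. Qed.

Lemma re_ofrM r x : re S (ofr S r * x) = r * re S x.
Proof. by case: S x => //= -[a b]; rewrite /= mul0r subr0. Qed.

Lemma reM_ge0 x y : 0 <= x -> re S (x * y) = re S x * re S y.
Proof. by move=> x0; rewrite -{1}(reK S x0) re_ofrM. Qed.

Lemma re1 : re S 1 = 1. Proof. by case: S. Qed.

Lemma ofr_gt0 r : 0 < r -> 0 < ofr S r.
Proof.
move=> r0; rewrite lt_neqAle ofr_ge0 ?ltW// andbT eq_sym.
by apply: contra_neq (lt0r_neq0 r0) => /(congr1 (re S)); rewrite ofrK re0.
Qed.

Lemma re_gt0 x : 0 < x -> 0 < re S x.
Proof.
move=> x0; rewrite lt_neqAle re_ge0 ?ltW// andbT eq_sym.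
by apply: contra_neq (lt0r_neq0 x0) => /(congr1 (ofr S)); rewrite reK ?ltW// ofr0.
Qed.

Lemma nrm_ge0 (V : normedModType K) (x : V) : 0 <= nrm S x.
Proof. exact: re_ge0. Qed.

Lemma nrm0 (V : normedModType K) : nrm S (0 : V) = 0.
Proof. by rewrite /nrm normr0 re0. Qed.

Lemma ofr_nrm (V : normedModType K) (x : V) : ofr S (nrm S x) = `|x|.
Proof. exact: reK. Qed.

Lemma nrmD (V : normedModType K) (x y : V) : nrm S (x + y) <= nrm S x + nrm S y.
Proof. by rewrite -reD; apply: ler_re; exact: ler_normD. Qed.

Lemma nrmN (V : normedModType K) (x : V) : nrm S (- x) = nrm S x.
Proof. by rewrite /nrm normrN. Qed.

Lemma nrmB (V : normedModType K) (x y : V) : nrm S (x - y) = nrm S (y - x).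
Proof. by rewrite -nrmN opprB. Qed.

Lemma nrmZ (V : normedModType K) a (x : V) :
  nrm S (a *: x) = re S `|a| * nrm S x.
Proof. by rewrite /nrm normrZ reM_ge0. Qed.

Lemma nrmZr (V : normedModType K) r (x : V) : 0 <= r ->
  nrm S (ofr S r *: x) = r * nrm S x.
Proof. by move=> r0; rewrite nrmZ ger0_norm ?ofr_ge0// ofrK. Qed.

End ScalarMorphisms.

(** * The Hahn-Banach theorem *)

Section HahnBanach.
Context (R : realType) (K : numFieldType) (S : scalars R K) (V : lmodType K).
Implicit Types (p q : V -> R).

(** The usual equality q(r x) = r q(x) for r >= 0 follows (sublinearZ); asking for
    one inequality, and for r > 0 only, shortens the constructions below. *)
Definition sublinear q := (forall x y, q (x + y) <= q x + q y) /\
  (forall (r : R) x, 0 < r -> q (ofr S r *: x) <= r * q x).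

Lemma sublinear0 q : sublinear q -> q 0 = 0.
Proof.
case=> _ qZ; have := qZ 2 0; have := qZ (2^-1) 0.
by rewrite !scaler0 invr_gt0 => /(_ (ltr0Sn _ _)) ? /(_ (ltr0Sn _ _)) ?; lra.
Qed.

Lemma sublinearZ q r x : sublinear q -> 0 <= r -> q (ofr S r *: x) = r * q x.
Proof.
move=> ql; rewrite le_eqVlt => /predU1P[<-|r0].
  by rewrite ofr0 scale0r sublinear0// mul0r.
apply/eqP; rewrite eq_le ql.2//= -ler_pdivlMl//.
rewrite -{1}[x](_ : ofr S r^-1 *: (ofr S r *: x) = x) ?ql.2 ?invr_gt0//.
by rewrite scalerA -ofrM mulVf ?gt_eqF// ofr1 scale1r.
Qed.

Lemma sublinear_lb q x y : sublinear q -> - q (- y) <= q (x + y) - q x.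
Proof.
by case=> qD _; have := qD (x + y) (- y); rewrite addrK => qq; lra.
Qed.

(** The common mechanism behind three infima: tangents of a sublinear functional,
    lower bounds of chains of sublinear functionals, and the seminorm used in
    Helly's lemma.  The index k plays the role of a sum, a minimum or a multiple
    of the given indices. *)
Lemma inf_sublinear (I : Type) (D : set I) (F : I -> V -> R) :
  D !=set0 -> (forall x, has_lbound [set F i x | i in D]) ->
  (forall i j x y, D i -> D j -> exists2 k, D k & F k (x + y) <= F i x + F j y) ->
  (forall r i x, 0 < r -> D i -> exists2 k, D k & F k (ofr S r *: x) <= r * F i x) ->
  sublinear (fun x => inf [set F i x | i in D]).
Proof.
move=> [i0 Di0] lb FD FZ.
have ne x : [set F i x | i in D] !=set0 by exists (F i0 x), i0.
split=> [x y|r x r0].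
  rewrite -lerBlDr; apply: lb_le_inf => // _ [i Di <-].
  rewrite lerBlDr -lerBlDl; apply: lb_le_inf => // _ [j Dj <-].
  rewrite lerBlDl; have [k Dk le_k] := FD i j x y Di Dj.
  by apply: le_trans le_k; apply: ge_inf => //; exists k.
rewrite -ler_pdivrMl//; apply: lb_le_inf => // _ [i Di <-].
rewrite ler_pdivrMl//; have [k Dk le_k] := FZ r i x r0 Di.
by apply: le_trans le_k; apply: ge_inf => //; exists k.
Qed.

(** The directional derivative of q at a, x |-> inf_(t >= 0) (q(x + t a) - t q(a)),
    lies below q and does not exceed -q(a) at -a.  So a minimal q satisfies
    q(-a) <= -q(a), which forces linearity. *)
Lemma sublinear_tangent q a : sublinear q ->
  exists q', [/\ sublinear q', forall x, q' x <= q x & q' (- a) <= - q a].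
Proof.
move=> ql; pose F t x := q (x + ofr S t *: a) - t * q a.
have lb x : has_lbound [set F t x | t in [set t | 0 <= t]].
  exists (- q (- x)) => _ [t /= t0 <-].
  by rewrite /F -(sublinearZ a ql t0) [x + _]addrC; exact: sublinear_lb.
exists (fun x => inf [set F t x | t in [set t | 0 <= t]]); split.
- apply: inf_sublinear => //.
  + by exists 0 => /=.
  + move=> s t x y /= s0 t0; exists (s + t); first exact: addr_ge0.
    have := ql.1 (x + ofr S s *: a) (y + ofr S t *: a).
    by rewrite /F ofrD scalerDl addrACA mulrDl => ?; lra.
  + move=> r t x r0 /= t0; exists (r * t); first by rewrite mulr_ge0// ltW.
    rewrite /F ofrM -scalerA -scalerDr.
    by have := ql.2 r (x + ofr S t *: a) r0; rewrite mulrBr mulrA => ?; lra.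
- move=> x; apply: ge_inf => //; exists 0 => //=.
  by rewrite /F ofr0 scale0r addr0 mul0r subr0.
- apply: ge_inf => //; exists 1; first exact: ler01.
  by rewrite /F ofr1 scale1r addNr sublinear0// mul1r sub0r.
Qed.

(** Zorn's lemma applies since a sublinear q <= p is bounded below by
    x |-> - p(- x), so that chains have pointwise infima. *)
Lemma minimal_sublinear p : sublinear p ->
  exists q, [/\ sublinear q, forall x, q x <= p x &
    forall q', sublinear q' -> (forall x, q' x <= q x) -> q' = q].
Proof.
move=> pl.
pose T := {q : V -> R | sublinear q /\ forall x, q x <= p x}.
pose le_T (q q' : T) := `[< forall x, sval q' x <= sval q x >].
have lbT (q : T) x : - p (- x) <= sval q x.
  case: q => q /= [ql qp]; apply: le_trans (_ : - q (- x) <= _).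
    by rewrite lerN2.
  by have := sublinear_lb 0 x ql; rewrite add0r sublinear0// subr0.
have [||||q qmin] := @Zorn T le_T.
- by move=> q; apply/asboolP.
- move=> q1 q2 q3 /asboolP q12 /asboolP q23; apply/asboolP => x.
  exact: le_trans (q12 x).
- move=> [q1 ?] [q2 ?] /asboolP q12 /asboolP q21; apply: eq_exist.
  by apply/funext => x; apply/eqP; rewrite eq_le q12 q21.
- move=> A Atot; have [[q0 Aq0]|A0] := pselect (A !=set0); last first.
    by exists (exist _ p (conj pl (fun=> lexx _))) => q Aq; case: A0; exists q.
  have lb x : has_lbound [set sval q x | q in A].
    by exists (- p (- x)) => _ [q _ <-].
  have il : sublinear (fun x => inf [set sval q x | q in A]).
    apply: inf_sublinear => //.
    + by exists q0.
    + move=> q1 q2 x y A1 A2; have [/asboolP le12|/asboolP le21] := Atot _ _ A1 A2.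
        by exists q2 => //; apply: le_trans ((svalP q2).1.1 x y) _; rewrite lerD2r.
      by exists q1 => //; apply: le_trans ((svalP q1).1.1 x y) _; rewrite lerD2l.
    + by move=> r q x r0 Aq; exists q => //; exact: (svalP q).1.2.
  have ip x : inf [set sval q x | q in A] <= p x.
    by apply: le_trans ((svalP q0).2 x); apply: ge_inf => //; exists q0.
  exists (exist (fun q => sublinear q /\ forall x, q x <= p x) _ (conj il ip)).
  move=> q Aq; apply/asboolP => x /=.
  by apply: ge_inf => //; exists q.
case: q qmin => q [ql qp] qmin; exists q; split=> // q' q'l q'q.
have q'p x : q' x <= p x by exact: le_trans (qp x).
by have /(congr1 sval) := qmin (exist _ q' (conj q'l q'p)) (asboolT q'q).
Qed.

(** A minimal functional below the tangent of p at w is real-linear, and its value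
    at - w is at most - p(w), which pins its value at w. *)
Lemma real_Hahn_Banach p w : sublinear p ->
  exists l : V -> R, [/\ forall x y, l (x + y) = l x + l y,
    forall r x, l (ofr S r *: x) = r * l x, forall x, l x <= p x & l w = p w].
Proof.
move=> pl; have [p' [p'l p'p p'w]] := sublinear_tangent w pl.
have [l [ll lp' lmin]] := minimal_sublinear p'l.
have lN x : l (- x) = - l x.
  have [l' [l'l l'le l'N]] := sublinear_tangent x ll.
  have := l'N; rewrite (lmin l')// => lNx.
  have := sublinear_lb 0 x ll; rewrite add0r sublinear0// subr0 => ?.
  by apply/eqP; rewrite eq_le lNx; lra.
have lp x : l x <= p x by exact: le_trans (p'p x).
exists l; split=> //.
- move=> x y; apply/eqP; rewrite eq_le ll.1 /=.
  by have := sublinear_lb x y ll; rewrite lN => ?; lra.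
- move=> r x; have [r0|/ltW r0] := leP 0 r; first exact: sublinearZ.
  have -> : ofr S r = - ofr S (- r).
    by apply/eqP; rewrite -addr_eq0 -ofrD subrr ofr0.
  by rewrite scaleNr lN sublinearZ ?oppr_ge0// mulNr opprK.
- apply/eqP; rewrite eq_le lp /=.
  by have := le_trans (lp' (- w)) p'w; rewrite lN lerN2.
Qed.

End HahnBanach.

(** In the complex case the real-linear l dominated by p is the real part of
    g(x) = l(x) - i l(i x).  Rotating x so that g(x) becomes a nonnegative real
    bounds |g(x)| by p(x); at w this bound forces the imaginary part to vanish. *)
Lemma Hahn_Banach (R : realType) (K : numFieldType) (S : scalars R K)
    (V : lmodType K) (p : V -> R) (w : V) :
  sublinear S p -> (forall a x, `|a| = 1 -> p (a *: x) <= p x) ->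
  exists g : V -> K^o, [/\ linear g, forall x, nrm S (g x) <= p x &
    g w = ofr S (p w)].
Proof.
move=> pl pZ; have [l [lD lZ lp lw]] := real_Hahn_Banach w pl.
case: S V p w pl pZ l lD lZ lp lw => V p w pl pZ l lD lZ lp lw.
  exists l; split=> //; first by move=> a x y; rewrite lD lZ.
  move=> x; rewrite /nrm /= ler_norml lp andbT lerNl.
  have -> : - l x = l (- x) by rewrite -mulN1r -lZ /= scaleN1r.
  apply: le_trans (lp _) _; rewrite -scaleN1r pZ//.
  by rewrite normrN1.
pose g x : R[i] := (Complex (l x) (- l ('i%C *: x))).
have lZr (r : R) x : l ((r%:C)%C *: x) = r * l x := lZ r x.
have gl : linear (g : V -> R[i]^o).
  move=> [a b] x y; rewrite /g.
  have lZc (z : V) : l (Complex a b *: z) = a * l z + b * l ('i%C *: z).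
    by rewrite [Complex a b]complexE /= scalerDl mulrC -scalerA lD !lZr.
  rewrite scalerDr !lD lZc scalerA [('i * _)%C]mulrC -scalerA lZc scalerA.
  have -> : ('i * 'i)%C *: x = - x :> V by rewrite -expr2 sqr_i scaleN1r.
  have -> : - x = ((- 1 : R)%:C)%C *: x by rewrite rmorphN1 scaleN1r.
  rewrite lZr mulN1r.
  by apply/eqP; rewrite eq_complex /=; apply/andP; split; apply/eqP; ring.
have gZ a x : g (a *: x) = a * g x.
  have g0 : g 0 = 0.
    by have := gl (-1) 0 0; rewrite scaler0 addr0 scaleN1r addNr.
  by have := gl a x 0; rewrite !addr0 g0 addr0.
have gp x : nrm (ComplexScalars R) (g x : R[i]^o) <= p x.
  have [gx0|gx0] := eqVneq (g x) 0.
    rewrite gx0 nrm0; apply: le_trans (lp x).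
    by rewrite -[l x]/(complex.Re (g x)) gx0.
  pose u := `|g x| / g x.
  have u1 : `|u| = 1 by rewrite normrM normfV normr_id divff ?normr_eq0.
  apply: le_trans (pZ u x u1); apply: le_trans (lp _).
  have -> : l (u *: x) = complex.Re (g (u *: x)) by [].
  by rewrite gZ divfK.
exists g; split=> //.
have := gp w; rewrite -[nrm _ _]/(complex.Re `|g w : R[i]|) normc_def /= lw => le_pw.
have pw0 : 0 <= p w by apply: le_trans le_pw; exact: sqrtr_ge0.
move: le_pw; rewrite -ler_sqr ?nnegrE ?sqrtr_ge0// sqr_sqrtr ?addr_ge0 ?sqr_ge0//.
rewrite gerDl sqrrN => l0; rewrite /g lw; congr Complex.
by apply/eqP; rewrite oppr_eq0 -sqrf_eq0 eq_le l0 sqr_ge0.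
Qed.

(** * Norming functionals and the weak-star topology *)

Section Duality.
Context (R : realType) (K : numFieldType) (S : scalars R K).
Implicit Types V W : normedModType K.

Lemma nrm_apply V (f : dual S V) x : nrm S (f x : K^o) <= nrm S f * nrm S x.
Proof.
by rewrite -reM_ge0 ?normr_ge0//; apply: ler_re; exact: dual_norm_apply.
Qed.

Lemma nrm_dual_le V (f : dual S V) M : 0 <= M ->
  (forall x, nrm S x <= 1 -> nrm S (f x : K^o) <= M) -> nrm S f <= M.
Proof.
move=> M0 fM; rewrite -[M](ofrK S); apply: ler_re.
rewrite [leLHS]/(dual_norm f) ler_ofr.
apply: ge_sup; first exact: (dual_has_sup f).1.
move=> _ [x x1 <-]; apply: fM.
by rewrite -(re1 S); exact: ler_re.
Qed.

Lemma unit_ballE V (x : V) : unit_ball V x = (nrm S x <= 1) :> Prop.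
Proof. by rewrite /unit_ball /= -(ofr_nrm S) -(ofr1 S) ler_ofr. Qed.

Lemma dual_of_linear V (g : V -> K^o) M : linear g ->
  0 <= M -> (forall x, nrm S (g x) <= M * nrm S x) ->
  exists2 f : dual S V, (forall x, f x = g x) & nrm S f <= M.
Proof.
move=> gl M0 gM.
have gP : g \in bounded_op V K^o.
  apply/asboolP; split=> //; exists (ofr S M) => x.
  by rewrite -!(ofr_nrm S) -ofrM ler_ofr.
exists (Bop gP : dual S V) => //; apply: nrm_dual_le => // x x1.
by apply: le_trans (gM x) _; rewrite ler_piMr.
Qed.

Lemma norming_functional V (x : V) :
  exists2 f : dual S V, nrm S f <= 1 & f x = ofr S (nrm S x).
Proof.
have nl : sublinear S (@nrm R K S V).
  split=> [y z|r y r0]; first exact: nrmD.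
  by rewrite nrmZr// ltW.
have [a y a1|g [gl gle gx]] := Hahn_Banach x nl.
  by rewrite nrmZ a1 re1 mul1r.
have [|f fg f1] := dual_of_linear gl ler01.
  by move=> y; rewrite mul1r.
by exists f; rewrite ?fg.
Qed.

Section Bidual.
Context (V : normedModType K).

Lemma bidual_embedding_bounded :
  @bidual_embedding R K S V \in bounded_op V (dual S (dual S V)).
Proof.
apply/asboolP; split; first by move=> a x y; apply: bopE => f; exact: linearP.
exists 1 => x; rewrite mul1r; apply: dual_norm_le => // f.
by rewrite mulrC; exact: (dual_norm_apply f x).
Qed.

Definition bidual_embedding_op : bop V (dual S (dual S V)) :=
  Bop bidual_embedding_bounded.

Lemma nrm_bidual_embedding (x : V) : nrm S (bidual_embedding S x) = nrm S x.
Proof.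
apply/eqP; rewrite eq_le; apply/andP; split.
  apply: nrm_dual_le => [|f f1]; first exact: nrm_ge0.
  by apply: le_trans (nrm_apply f x) _; rewrite ler_piMl ?nrm_ge0.
have [f f1 fx] := norming_functional x.
have := nrm_apply (bidual_embedding S x) f.
rewrite -[bidual_embedding S x f]/(f x) fx.
rewrite /nrm ger0_norm ?ofr_ge0 ?re_ge0// ofrK => /le_trans; apply.
by rewrite ler_piMr// re_ge0.
Qed.

End Bidual.

(** Finite lists of test points replace the product topology in all later
    approximation arguments. *)
Lemma weak_star_closureP V (A : set (weak_star S V)) (z : dual S V) :
  closure A (z : weak_star S V) <-> forall (s : seq V) (e : R), 0 < e ->
    exists2 a : dual S V, A a & forall x, x \in s -> nrm S (z x - a x : K^o) <= e.
Proof.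
split=> [Az s e e0|H].
  have : nbhs (z : weak_star S V)
      [set a : weak_star S V | forall x, x \in s ->
        nrm S (z x - (a : dual S V) x : K^o) <= e].
    elim: s => [|x s IHs].
      by apply: filterE.
    have evc : {for z, continuous (fun a : weak_star S V => (a : dual S V) x : K^o)}.
      apply: (@continuous_comp (weak_star S V) {ptws V -> K^o} K^o
        (fun a => (a : dual S V) : V -> K^o) (fun h => h x)).
        exact: initial_continuous.
      exact: (@proj_continuous V (fun=> K^o) x).
    have /cvgrPdist_le/(_ _ (ofr_gt0 S e0)) Hx := evc.
    apply: filterS2 Hx IHs => a ax IHa y; rewrite inE => /predU1P[->|/IHa//].
    by rewrite -[e](ofrK S); apply: ler_re.
  by move=> /Az[a [Aa az]]; exists a.
(* The basic neighbourhoods B of z form a filter base; its filter F converges to z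
   pointwise, hence in the weak-star topology. *)
pose B (i : seq V * R) : set (weak_star S V) :=
  [set a | forall x, x \in i.1 -> nrm S (z x - (a : dual S V) x : K^o) <= i.2].
pose F := filter_from [set i : seq V * R | 0 < i.2] B.
have FF : Filter F.
  apply: filter_from_filter; first by exists ([::], 1) => /=.
  move=> [s1 e1] [s2 e2] /= e10 e20; exists (s1 ++ s2, Num.min e1 e2) => /=.
    by rewrite lt_min e10.
  move=> a Ba; split=> x xs; have := Ba x; rewrite /= mem_cat xs ?orbT => /(_ isT).
    by rewrite le_min => /andP[].
  by rewrite le_min => /andP[].
have Fz : F --> (z : weak_star S V).
  have Fp : {ptws, (fun a : weak_star S V => (a : dual S V) : V -> K^o) @ F -->
      (z : V -> K^o)}.
    apply/pointwise_cvgP => x; apply/cvgrPdist_le => e e0.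
    exists ([:: x], re S e) => /=.
      exact: re_gt0.
    move=> a /(_ x); rewrite /= inE eqxx => /(_ isT) ax.
    by rewrite -(ofr_nrm S) -(reK S (ltW e0)) ler_ofr.
  move=> U; rewrite nbhsE => -[_ [[C Cop <-] Cz] CU].
  have /Fp : nbhs (z : {ptws V -> K^o}) C by apply: open_nbhs_nbhs.
  by rewrite nbhs_simpl => FC; exact: (@filterS _ F _ _ _ CU FC).
move=> U /Fz [[s e] /= e0 BU].
by have [a Aa az] := H s e e0; exists a; split=> //; exact: BU.
Qed.

End Duality.
Arguments unit_ballE {R K} S {V} x.

(** * Goldstine's theorem *)

Section Goldstine.
Context (R : realType) (K : numFieldType) (S : scalars R K).
Context (V : normedModType K).

Lemma dual_sum_apply n (c : 'I_n -> K) (f : 'I_n -> dual S V) x :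
  (\sum_i c i *: f i) x = \sum_i c i * f i x.
Proof.
rewrite -[LHS]/(bidual_embedding S x (\sum_i c i *: f i)) linear_sum.
by apply: eq_bigr => i _; rewrite linearZ.
Qed.

(** Let w be the vector of the psi(f_i) and q the seminorm
    q(v) = inf_y (|y| + e^-1 sum_i |v_i - f_i(y)|) on K^n.  A linear g <= q with
    g(w) = q(w) has the form v |-> sum_i c_i v_i.  Testing q with y itself gives
    |sum_i c_i f_i(y)| <= |y|, so sum_i c_i f_i lies in the dual ball and
    q(w) = psi(sum_i c_i f_i) <= 1.  Any y nearly attaining q(w) works. *)
Lemma Helly (n : nat) (f : 'I_n -> dual S V) (psi : dual S (dual S V)) (e : R) :
  nrm S psi <= 1 -> 0 < e -> exists2 y : V, nrm S y <= 1 + e &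
    forall i, nrm S (psi (f i) - f i y : K^o) <= e * (1 + e).
Proof.
move=> psi1 e0.
pose F y (v : 'rV[K]_n) := nrm S y + (\sum_i nrm S (v 0 i - f i y : K^o)) / e.
pose q v := inf [set F y v | y in [set: V]].
have nrm_sum_ge0 (v : 'I_n -> K^o) : 0 <= \sum_i nrm S (v i).
  by apply: sumr_ge0 => i _; exact: nrm_ge0.
have F0 y v : 0 <= F y v.
  by rewrite addr_ge0 ?nrm_ge0// divr_ge0 ?nrm_sum_ge0// ltW.
have lbF v : has_lbound [set F y v | y in [set: V]].
  by exists 0 => _ [y _ <-].
have FZ a y v : F (a *: y) (a *: v) = re S `|a| * F y v.
  rewrite /F nrmZ mulrDr; congr (_ + _); rewrite mulrA; congr (_ / _).
  rewrite mulr_sumr; apply: eq_bigr => i _.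
  by rewrite mxE linearZ /= -mulrBr [LHS]nrmZ.
have qF y v : q v <= F y v by apply: ge_inf => //; exists y.
have ql : sublinear S q.
  apply: inf_sublinear => //.
  - by exists 0.
  - move=> y z v w _ _; exists (y + z) => //.
    rewrite /F [leRHS]addrACA lerD ?nrmD// -mulrDl ler_wpM2r ?invr_ge0 ?(ltW e0)//.
    rewrite -big_split; apply: ler_sum => i _ /=.
    by rewrite mxE linearD opprD addrACA; exact: nrmD.
  - move=> r y v r0 _; exists (ofr S r *: y) => //.
    by rewrite FZ ger0_norm ?ofr_ge0 ?(ltW r0)// ofrK.
pose w : 'rV[K]_n := \row_i psi (f i).
have [a v a1|g [gl gq gw]] := Hahn_Banach w ql.
  apply: lb_le_inf => [|_ [y _ <-]]; first by exists (F 0 v), 0.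
  by apply: le_trans (qF (a *: y) _) _; rewrite FZ a1 re1 mul1r.
have gE v : g v = \sum_i v 0 i * g (delta_mx 0 i).
  pose G : {linear 'rV[K]_n -> K^o} := HB.pack g (GRing.isLinear.Build _ _ _ _ g gl).
  rewrite -[g]/(G : _ -> _) {1}[v]row_sum_delta linear_sum.
  by apply: eq_bigr => i _; rewrite linearZ.
pose h : dual S V := \sum_i (g (delta_mx 0 i) : K) *: f i.
have h1 : nrm S h <= 1.
  apply: nrm_dual_le => // y y1; apply: le_trans y1.
  have -> : h y = g (\row_i f i y).
    by rewrite gE dual_sum_apply; apply: eq_bigr => i _; rewrite mxE mulrC.
  apply: le_trans (gq _) _; apply: le_trans (qF y _) _.
  rewrite /F big1 ?mul0r ?addr0// => i _.
  by rewrite mxE subrr nrm0.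
have qw1 : q w <= 1.
  have psih : psi h = ofr S (q w).
    rewrite -gw gE linear_sum; apply: eq_bigr => i _.
    by rewrite linearZ mxE [RHS]mulrC.
  have := nrm_apply psi h; rewrite psih /nrm.
  have q0 : 0 <= q w by apply: lb_le_inf => [|_ [y _ <-]//]; exists (F 0 w), 0.
  rewrite ger0_norm ?ofr_ge0// ofrK => /le_trans; apply.
  by rewrite mulr_ile1 ?re_ge0.
have [_ [y _ <-] Fy] : exists2 r, [set F y w | y in [set: V]] r & r < 1 + e.
  apply: inf_lt; last by apply: le_lt_trans qw1 _; rewrite ltrDl.
  by exists (F 0 w), 0.
exists y.
  apply/ltW; apply: le_lt_trans Fy; rewrite lerDl divr_ge0 ?nrm_sum_ge0// ltW//.
move=> i; rewrite mulrC -ler_pdivrMr//; apply/ltW; apply: le_lt_trans Fy.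
rewrite ler_wpDl ?nrm_ge0// ler_wpM2r ?invr_ge0 ?(ltW e0)//.
rewrite (bigD1 i)//= mxE lerDl.
by apply: sumr_ge0 => j _; exact: nrm_ge0.
Qed.

Lemma Goldstine (psi : dual S (dual S V)) : nrm S psi <= 1 ->
  closure (@bidual_embedding R K S V @` unit_ball V : set (weak_star S (dual S V)))
    psi.
Proof.
move=> psi1; apply/weak_star_closureP => s e e0.
pose M : R := \sum_(f <- s) nrm S f.
have M0 : 0 <= M by apply: sumr_ge0 => f _; exact: nrm_ge0.
(* Helly's lemma with error d gives |y| <= 1 + d.  Rescaling y into the ball costs at
   most d M in each f, for a total error d (1 + d) + d M <= d (2 + M) <= e. *)
pose d := e / (2 + M + e).
have d0 : 0 < d by rewrite divr_gt0//; lra.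
have de : d * (2 + M + e) = e by rewrite divfK// gt_eqF//; lra.
have d1 : d <= 1 by rewrite ler_pdivrMr; lra.
have [y y1 ypsi] := Helly (fun i : 'I_(size s) => s`_i) psi1 d0.
have d10 : 0 < 1 + d by lra.
pose x := ofr S (1 + d)^-1 *: y.
have xE : y = x + ofr S d *: x.
  rewrite -[X in _ = X + _]scale1r -scalerDl -(ofr1 S) -ofrD scalerA -ofrM.
  by rewrite divff ?gt_eqF// ofr1 scale1r.
have x1 : nrm S x <= 1 by rewrite nrmZr ?invr_ge0 ?(ltW d10)// ler_pdivrMl// mulr1.
exists (bidual_embedding S x); first by exists x => //; rewrite (unit_ballE S).
move=> f fs; rewrite -[bidual_embedding S x f]/(f x).
have fx : nrm S (f (ofr S d *: x) : K^o) <= d * nrm S f.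
  rewrite linearZ nrmZr ?(ltW d0)// ler_wpM2l ?(ltW d0)//.
  by apply: le_trans (nrm_apply f x) _; rewrite ler_piMr ?nrm_ge0.
have fM : nrm S f <= M.
  by rewrite /M (big_rem f)//= lerDl; apply: sumr_ge0 => g _; exact: nrm_ge0.
have := fs; rewrite -index_mem => fi.
have := ypsi (Ordinal fi); rewrite /= nth_index// => fy.
have -> : psi f - f x = (psi f - f y) + f (ofr S d *: x).
  by rewrite {1}xE linearD opprD addrA subrK.
apply: le_trans (nrmD _ _ _) _.
have dM : d * nrm S f <= d * M by rewrite ler_wpM2l// (ltW d0).
have dd : d * d <= d * 1 by rewrite ler_wpM2l// (ltW d0).
by move: fy de; rewrite !mulrDr => fy de; nra.
Qed.

End Goldstine.

(** * Weak noncompactness and the biadjoint *)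

Section WeakNonCompactness.
Context (R : realType) (K : numFieldType) (S : scalars R K).

Lemma wk_lt (V : normedModType K) (A : set V) (s : R) (z : dual S (dual S V)) :
  (wk S A < s%:E)%E ->
  closure (@bidual_embedding R K S V @` A : set (weak_star S (dual S V))) z ->
  exists x : V, nrm S (z - bidual_embedding S x) < s.
Proof.
move=> As Az.
have : (dist S z (range (@bidual_embedding R K S V)) < s%:E)%E.
  by apply: le_lt_trans As; apply: ereal_sup_ubound; exists z.
by move=> /ereal_inf_lt[_ [_ [x _ <-] <-]]; rewrite lte_fin; exists x.
Qed.

Lemma adjoint2_bidual_embedding (V W : normedModType K) (T : bop V W) x :
  adjoint S (adjoint S T) (bidual_embedding S x) = bidual_embedding S (T x).
Proof. exact: bopE. Qed.

(** Goldstine's theorem carried over by T^**: testing T^** psi on f amounts to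
    testing psi on T^* f. *)
Lemma biadjoint_in_closure (V W : normedModType K) (T : bop V W)
  (psi : dual S (dual S V)) : nrm S psi <= 1 ->
  closure (@bidual_embedding R K S W @` (T @` unit_ball V)
    : set (weak_star S (dual S W))) (adjoint S (adjoint S T) psi).
Proof.
move=> /Goldstine/weak_star_closureP psic; apply/weak_star_closureP => s e e0.
have [_ [x x1 <-] xs] := psic (map (adjoint S T) s) e e0.
exists (bidual_embedding S (T x)); first by exists (T x) => //; exists x.
by move=> f fs; exact: (xs _ (map_f (adjoint S T) fs)).
Qed.

Arguments biadjoint_in_closure {V W} T {psi}.

(** The difference u - J x, with u = T^** psi close to z and x in W, has norm below
    s and is tested twice: on chi and on f = chi o J.  The third s comes from
    approximating the restriction of z to W^* by an element of W. *)
Lemma wk_biadjoint (V W : normedModType K) (T : bop V W) (s : R) :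
  (wk_op S T < s%:E)%E -> (wk_op S (adjoint S (adjoint S T)) <= (3 * s)%:E)%E.
Proof.
move=> Ts; apply: ub_ereal_sup => _ [z zc <-].
pose JW := bidual_embedding_op S W.
pose JW' := bidual_embedding_op S (dual S W).
have {zc} := (weak_star_closureP _ _).1 zc => zc.
(* The restriction of z to W^* is again in the weak-star closure of J(T(B_V)). *)
have [x1 x1z] : exists x1 : W, nrm S (adjoint S JW' z - JW x1) < s.
  apply: (wk_lt Ts); apply/weak_star_closureP => l e e0.
  have e20 : 0 < e / 2 by rewrite divr_gt0.
  have [_ [_ [psi psi1 <-] <-] zpsi] := zc (map JW' l) _ e20.
  rewrite (unit_ballE S) in psi1.
  have /weak_star_closureP/(_ l _ e20)[a Aa apsi] := biadjoint_in_closure T psi1.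
  exists a => // f fl; have := zpsi _ (map_f JW' fl); have := apsi f fl.
  set u := adjoint S _ psi.
  have -> : adjoint S JW' z f - a f = (z (JW' f) - u f) + (u f - a f).
    by rewrite addrA subrK.
  move=> h1 h2; apply: le_trans (nrmD _ _ _) _; rewrite [e]splitr lerD//.
apply: (@le_trans _ _ (nrm S (z - bidual_embedding S (JW x1)))%:E).
  apply: ereal_inf_lbound; exists (bidual_embedding S (JW x1)) => //; exact: imageT.
rewrite lee_fin.
have s0 : 0 <= s by apply: le_trans (ltW x1z); exact: nrm_ge0.
apply: nrm_dual_le; first by rewrite mulr_ge0.
move=> chi chi1; apply/ler_addgt0Pr => e e0.
have e20 : 0 < e / 2 by rewrite divr_gt0.
(* A single psi serves both chi and J f, so that their values at T^** psi can be
   compared. *)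
pose f : dual S W := adjoint S JW chi.
have [_ [_ [psi psi1 <-] <-] zpsi] := zc [:: chi; JW' f] _ e20.
rewrite (unit_ballE S) in psi1.
have := zpsi chi; rewrite inE eqxx => /(_ isT); have := zpsi (JW' f).
rewrite !inE eqxx orbT => /(_ isT) {zpsi}.
have [x xpsi] := wk_lt Ts (biadjoint_in_closure T psi1).
move: xpsi; set u := adjoint S _ psi => xpsi zf zchi.
pose v := u - bidual_embedding S x.
have chi_v : nrm S (chi v : K^o) <= s.
  apply: le_trans (nrm_apply chi v) _; rewrite -[s]mul1r.
  by rewrite ler_pM ?nrm_ge0// ltW.
have f1 : nrm S f <= 1.
  apply: nrm_dual_le => // y y1.
  apply: le_trans (nrm_apply chi (JW y)) _.
  by rewrite nrm_bidual_embedding mulr_ile1 ?nrm_ge0.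
have vf : nrm S (v f : K^o) <= s.
  apply: le_trans (nrm_apply v f) _; rewrite -[s]mulr1.
  by rewrite ler_pM ?nrm_ge0// ltW.
pose v1 := adjoint S JW' z - JW x1.
have v1f : nrm S (v1 f : K^o) <= s.
  apply: le_trans (nrm_apply v1 f) _; rewrite -[s]mulr1.
  by rewrite ler_pM ?nrm_ge0// ltW.
have -> : (z - bidual_embedding S (JW x1)) chi =
    (z chi - chi u) + (chi v + ((u f - z (JW' f)) + (v1 f - v f))).
  have -> : chi v = chi u - f x by exact: linearB.
  rewrite -[LHS]/(z chi - f x1) -[v f]/(u f - f x).
  rewrite -[v1 f]/(z (JW' f) - f x1).
  move: (z chi) (chi u) (f x) (u f) (z (JW' f)) (f x1) => a b c d g h.
  change (a - h = (a - b) + ((b - c) + ((d - g) + ((g - h) - (d - c)))) :> K).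
  by ring.
apply: le_trans (nrmD _ _ _) _; apply: le_trans (lerD zchi (nrmD _ _ _)) _.
have := nrmD S (u f - z (JW' f) : K^o) (v1 f - v f).
have := nrmD S (v1 f : K^o) (- v f); rewrite nrmN.
by move: zf; rewrite nrmB => ? ? ?; lra.
Qed.

(** The previous bound as s decreases to wk(T). *)
Lemma wk_biadjoint_le (V W : normedModType K) (T : bop V W) :
  (wk_op S (adjoint S (adjoint S T)) <= 3%:E * wk_op S T)%E.
Proof.
have [r|] := leP +oo%E (wk_op S T).
  by rewrite leye_eq in r; rewrite (eqP r) gt0_muley ?leey// lte_fin.
move=> Too; apply/lee_addgt0Pr => e e0.
have e30 : 0 < e / 3 by rewrite divr_gt0.
have T0 : (0 <= wk_op S T)%E.
  rewrite leNgt; apply/negP => T0.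
  have [|x] := @wk_lt W (T @` unit_ball V) 0 (bidual_embedding S (T 0)) T0.
    apply: subset_closure; exists (T 0) => //; exists 0 => //.
    by rewrite /unit_ball /= normr0.
  by rewrite ltNge nrm_ge0.
have [r Tr] : exists r, wk_op S T = r%:E.
  by exists (fine (wk_op S T)); rewrite fineK// ge0_fin_numE.
rewrite Tr -EFinM -EFinD.
have -> : 3 * r + e = 3 * (r + e / 3) by rewrite mulrDr [3 * (e / 3)]mulrC divfK.
by apply: wk_biadjoint; rewrite Tr lte_fin ltrDl.
Qed.

Lemma weakly_cauchy_bidual (V : normedModType K) (z : nat -> V) :
  weakly_cauchy S z -> weakly_cauchy S (bidual_embedding_op S V \o z).
Proof. by move=> zc f; exact: (zc (adjoint S (bidual_embedding_op S V) f)). Qed.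

Lemma ca_bidual (V : normedModType K) (z : nat -> V) :
  ca S (bidual_embedding_op S V \o z) = ca S z.
Proof.
have nrmJ k l : nrm S (bidual_embedding_op S V (z k) -
    bidual_embedding_op S V (z l)) = nrm S (z k - z l).
  by rewrite -linearB; exact: nrm_bidual_embedding.
rewrite /ca; congr ereal_inf; apply: eq_imagel => n _; congr ereal_sup.
by apply/seteqP; split=> _ [k nk [l nl <-]]; exists k => //; exists l => //=;
  rewrite nrmJ.
Qed.

Lemma cc_le_biadjoint (V W : normedModType K) (T : bop V W) :
  (cc S T <= cc S (adjoint S (adjoint S T)))%E.
Proof.
apply: ub_ereal_sup => _ [z [zc z1] <-]; apply: ereal_sup_ubound.
exists (bidual_embedding_op S V \o z).
  split; first exact: weakly_cauchy_bidual.
  by move=> k; rewrite (unit_ballE S) nrm_bidual_embedding -(unit_ballE S).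
rewrite -[RHS]ca_bidual; congr (ca S _); apply/funext => k /=.
exact: adjoint2_bidual_embedding.
Qed.

End WeakNonCompactness.

(** * Passing the quantitative properties from the dual *)

Theorem theorem5p7 (R : realType) (K : numFieldType) (S : scalars R K)
    (X : completeNormedModType K) :
  (dual_quantitative_DP S (dual S X) -> direct_quantitative_DP S X) /\
  (direct_quantitative_DP S (dual S X) -> dual_quantitative_DP S X).
Proof.
split=> -[C C0 XC].
  exists C => // Y T; apply: le_trans (cc_le_biadjoint S T) _.
  exact: (XC (dual S Y) (adjoint S T)).
exists (C * 3); first by rewrite mulr_gt0.
move=> Y T; apply: le_trans (XC (dual S Y) (adjoint S T)) _.
rewrite EFinM -muleA lee_wpmul2l ?lee_fin ?(ltW C0)//.
exact: wk_biadjoint_le.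
Qed.
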